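(* Suppose that $\mathbf h\in\mathbb Z^3\setminus\{\mathbf 0\}$ and $\varepsilon>0$. Then $S_3(P;\mathbf h)\ll P^{2+\varepsilon}$ for positive integers $P$, where the implied constant depends only on $\varepsilon$.
   Context: For a positive integer $P$ and $\mathbf h=(h_1,h_2,h_3)\in\mathbb Z^3$, $S_3(P;\mathbf h)$ denotes the number of integer tuples $(x_1,x_2,x_3,y_1,y_2,y_3)$ with $1\le x_i,y_i\le P$ $(1\le i\le 3)$ satisfying $$\sum_{i=1}^3(x_i^j-y_i^j)=h_j\quad (j=1,2,3).$$ *)

(* Defs.v *)
From HB Require Import structures.
From mathcomp Require Import all_boot all_order all_algebra.
Set Implicit Arguments.
Unset Strict Implicit.
Unset Printing Implicit Defensive.
Import Order.TTheory GRing.Theory Num.Theory.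
Local Open Scope ring_scope.

(* The pair of tuples (x, y) ranges over {0, ..., P}^3 x {0, ..., P}^3, with 0
   excluded explicitly.  Entries of h are indexed from 0, so the equation of
   degree j.+1 has right-hand side h 0 j. *)
Definition S3 (P : nat) (h : 'rV[int]_3) : nat :=
  #|[set xy : {ffun 'I_3 -> 'I_P.+1} * {ffun 'I_3 -> 'I_P.+1} |
      [forall i : 'I_3, (1 <= xy.1 i)%N && (1 <= xy.2 i)%N]
      && [forall j : 'I_3,
            \sum_(i < 3) ((xy.1 i)%:Z ^+ j.+1 - (xy.2 i)%:Z ^+ j.+1)
              == h 0 j]]|.

(* Main.v *)
(** For the system in two pairs with right-hand side (a, b, c), the quantity
    a^4 + 3 b^2 - 4 a c equals 12 times the product of the four x_i - y_j.  If it
    is nonzero, x_1 - y_1 and x_1 - y_2 divide a fixed nonzero integer of size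
    at most P^4 and determine the solution, so the divisor bound leaves O(P^eps)
    solutions; if it vanishes, some x_i equals some y_j and this pair cancels.
    For three pairs, fix (x_3, y_3) in at most (P + 1)^2 ways: either the
    remaining system is nondegenerate, or a cancellation reduces the count to
    O(P) times the number of solutions of the system in two pairs with the same
    nonzero h, which is O(P^(1 + eps)) by the same dichotomy. *)
Require Import Defs.
From HB Require Import structures.
From mathcomp Require Import all_boot all_order all_algebra.
From mathcomp Require Import zify ring.
From mathcomp Require Import reals exp.
Set Implicit Arguments.
Unset Strict Implicit.
Unset Printing Implicit Defensive.
Import Order.TTheory GRing.Theory Num.Theory.

(** * The divisor bound *)

(** A divisor [e] of [m * n] is the product of [gcdn e m], which divides [m], and [e %/ gcdn e m],
    which divides [n]. *)
Lemma size_divisorsM_le m n : 0 < m -> 0 < n ->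
  size (divisors (m * n)) <= size (divisors m) * size (divisors n).
Proof.
move=> m_gt0 n_gt0.
rewrite -(size_allpairs muln (divisors m) (divisors n)).
apply: uniq_leq_size (divisors_uniq _) _ => e.
rewrite -dvdn_divisors ?muln_gt0 ?m_gt0 // => dv_e.
have g_gt0 : 0 < gcdn e m by rewrite gcdn_gt0 m_gt0 orbT.
have Ee : e = gcdn e m * (e %/ gcdn e m) by rewrite mulnC divnK ?dvdn_gcdl.
apply/allpairsP; exists (gcdn e m, e %/ gcdn e m); split=> //=.
  by rewrite -dvdn_divisors // dvdn_gcdr.
rewrite -dvdn_divisors //.
have co : coprime (e %/ gcdn e m) (m %/ gcdn e m).
  rewrite /coprime -(eqn_pmul2r g_gt0) muln_gcdl !divnK ?dvdn_gcdl ?dvdn_gcdr //.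
  by rewrite mul1n.
rewrite -(Gauss_dvdr _ co) -(@dvdn_pmul2l (gcdn e m)) // -Ee mulnA.
by rewrite [gcdn e m * _]mulnC divnK ?dvdn_gcdr.
Qed.

Lemma size_divisors_pfactor_le p a : prime p -> size (divisors (p ^ a)) <= a.+1.
Proof.
move=> p_pr; rewrite -[leqRHS](size_iota 0) -[leqRHS](size_map (expn p)).
apply: uniq_leq_size (divisors_uniq _) _ => e.
rewrite -dvdn_divisors ?expn_gt0 ?prime_gt0 // => /(dvdn_pfactor _ _ p_pr)[i le_ia ->].
by apply: map_f; rewrite mem_iota.
Qed.

Lemma leq_bin_2exp n m : 'C(n, m) <= 2 ^ n.
Proof.
have [lt_nm|le_mn] := ltnP n m; first by rewrite bin_small.
rewrite -[2]/(1 + 1) expnDn (bigD1 (Ordinal (le_mn : m < n.+1))) //=.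
rewrite !exp1n !muln1.
exact: leq_addr.
Qed.

Lemma leq_expr k m n : m <= n -> m ^ k <= n ^ k.
Proof. by case: k => // k; rewrite leq_exp2r. Qed.

Lemma expn_le_ffact a k : a.+1 ^ k <= (a + k) ^_ k.
Proof.
elim: k => // k IHk; rewrite expnS addnS ffactSS leq_mul //.
by rewrite ltnS leq_addr.
Qed.

Lemma expn_succ_le k a : a.+1 ^ k <= k`! * 2 ^ k * 2 ^ a.
Proof.
apply: leq_trans (expn_le_ffact a k) _.
rewrite -bin_ffact mulnC -mulnA leq_mul2l -expnD addnC leq_bin_2exp orbT //.
Qed.

(* A prime power p^a with p >= 2^k satisfies (a + 1)^k <= p^a, so that only the
   primes below 2^k cost a constant factor. *)
Lemma divisor_bound_primes k (s : seq nat) n : 0 < n -> {subset primes n <= s} ->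
  size (divisors n) ^ k <= (k`! * 2 ^ k) ^ count (fun p => p < 2 ^ k) s * n.
Proof.
elim: s n => [|p s IHs] n n_gt0 sub.
  suff -> : n = 1 by rewrite (_ : size (divisors 1) = 1) ?exp1n.
  apply/eqP; rewrite eqn_leq n_gt0 andbT leqNgt; apply/negP => n_gt1.
  by have := sub (pdiv n); rewrite mem_primes pdiv_prime // n_gt0 pdiv_dvd => /(_ isT).
have [p_n|p_n] := boolP (p \in primes n); last first.
  apply: leq_trans (IHs n n_gt0 _) _.
    move=> q qn; have := sub q qn; rewrite inE => /predU1P[Eq|//].
    by rewrite -Eq qn in p_n.
  rewrite leq_mul2r /= leq_pexp2l ?leq_addl ?orbT //.
  by rewrite muln_gt0 fact_gt0 expn_gt0.
have p_pr : prime p by move: p_n; rewrite mem_primes => /andP[].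
have := partnC p n_gt0; rewrite p_part.
set a := logn p n; set m := n`_p^' => <-.
have m_gt0 : 0 < m by apply: part_gt0.
have IHm : size (divisors m) ^ k <= (k`! * 2 ^ k) ^ count (fun p => p < 2 ^ k) s * m.
  apply: IHs => // q; rewrite primes_part mem_filter => /andP[q_p /sub].
  by rewrite inE => /predU1P[Eq|//]; rewrite Eq !inE eqxx in q_p.
have Ha : size (divisors (p ^ a)) ^ k <= (k`! * 2 ^ k) ^ (p < 2 ^ k) * p ^ a.
  apply: leq_trans (leq_expr k (size_divisors_pfactor_le a p_pr)) _.
  have [lt_p|le_p] := ltnP p (2 ^ k).
    apply: leq_trans (expn_succ_le k a) _.
    by rewrite expn1 leq_mul2l leq_expr ?prime_gt1 ?orbT.
  (* Here [p ^ a] is at least [(2 ^ k) ^ a = (2 ^ a) ^ k], and [a + 1 <= 2 ^ a]. *)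
  rewrite expn0 mul1n; apply: leq_trans (leq_expr a le_p).
  by rewrite -expnM mulnC expnM leq_expr // ltn_expl.
apply: leq_trans (leq_expr k (size_divisorsM_le _ m_gt0)) _.
  by rewrite expn_gt0 prime_gt0.
by rewrite expnMn /= expnD mulnACA leq_mul.
Qed.

(** The bound n^(1/k) for the number of divisors, up to a constant, raised to the power [k] to stay
    in the natural numbers. Fewer than [2 ^ k] primes lie below [2 ^ k], whence the exponent in the
    constant. *)
Lemma divisor_bound k : exists2 K, 0 < K &
  forall n, 0 < n -> size (divisors n) ^ k <= K * n.
Proof.
exists ((k`! * 2 ^ k) ^ (2 ^ k)); first by rewrite !(expn_gt0, muln_gt0, fact_gt0).
move=> n n_gt0; apply: leq_trans (divisor_bound_primes k n_gt0 (fun _ => id)) _.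
rewrite leq_mul2r leq_pexp2l ?orbT ?muln_gt0 ?fact_gt0 ?expn_gt0 //.
rewrite -size_filter -[leqRHS](size_iota 0).
apply: uniq_leq_size => [|p]; first by rewrite filter_uniq ?primes_uniq.
by rewrite mem_filter mem_iota => /andP[].
Qed.

Local Open Scope ring_scope.

(** * Systems in one, two and three pairs *)

Definition power_diff n k (p : 'I_n * 'I_n) : int :=
  p.1%:Z ^+ k - p.2%:Z ^+ k.

Definition sols1 n (a b c : int) : {set 'I_n * 'I_n} :=
  [set p | [&& power_diff 1 p == a, power_diff 2 p == b & power_diff 3 p == c]].

(* An element is ((x1, y1), (x2, y2)). *)
Definition sols2 n (a b c : int) : {set ('I_n * 'I_n) * ('I_n * 'I_n)} :=
  [set q | [&& power_diff 1 q.1 + power_diff 1 q.2 == a,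
               power_diff 2 q.1 + power_diff 2 q.2 == b &
               power_diff 3 q.1 + power_diff 3 q.2 == c]].

Definition sols3 n (a b c : int) :
    {set ('I_n * 'I_n) * (('I_n * 'I_n) * ('I_n * 'I_n))} :=
  [set r | r.2 \in sols2 n (a - power_diff 1 r.1) (b - power_diff 2 r.1)
                           (c - power_diff 3 r.1)].

Definition resolvent (a b c : int) : int := a ^+ 4 + 3 * b ^+ 2 - 4 * a * c.

Definition cross_prod n (q : ('I_n * 'I_n) * ('I_n * 'I_n)) : int :=
  (q.1.1%:Z - q.1.2%:Z) * (q.1.1%:Z - q.2.2%:Z) *
  (q.2.1%:Z - q.1.2%:Z) * (q.2.1%:Z - q.2.2%:Z).

(* Up to the factor 12 this is the supersymmetric Schur function
   s_(2,2) = h_2^2 - h_1 h_3, which factors as the product of the x_i - y_j. *)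
Lemma resolvent_cross_prod n a b c q :
  q \in sols2 n a b c -> resolvent a b c = 12 * cross_prod q.
Proof.
rewrite inE => /and3P[/eqP <- /eqP <- /eqP <-].
case: q => [[x1 y1] [x2 y2]]; rewrite /resolvent /cross_prod /power_diff /=; ring.
Qed.

(** If x = y, then a, b and c all vanish. So a = x - y is nonzero, and b = a (x + y) fixes x + y. *)
Lemma card_sols1_le1 n a b c :
  ~~ [&& a == 0, b == 0 & c == 0] -> (#|sols1 n a b c| <= 1)%N.
Proof.
move=> nz; apply/card_le1_eqP => -[x y] [x' y'] /=.
rewrite !inE /power_diff /= => /and3P[/eqP Ea /eqP Eb /eqP Ec].
move=> /and3P[/eqP Ea' /eqP Eb' /eqP Ec'].
have a_neq0 : a != 0.
  apply: contra nz => /eqP a0; have Exy : x%:Z = y%:Z by apply: subr0_eq; rewrite -a0 -Ea.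
  by rewrite -Eb -Ec Exy a0 !subrr !eqxx.
have Ey : y%:Z = x%:Z - a by rewrite -Ea; ring.
have Ey' : y'%:Z = x'%:Z - a by rewrite -Ea'; ring.
have : a * (x%:Z - x'%:Z) = 0.
  apply: (@mulfI _ 2) => //; rewrite mulr0.
  by rewrite -[RHS](subrr b) -{1}Eb -Eb' Ey Ey'; ring.
move/eqP; rewrite mulf_eq0 (negPf a_neq0) /= => /eqP/subr0_eq Ex.
by congr pair; apply: val_inj; apply: (can_inj absz_nat); rewrite //= Ey Ey' Ex.
Qed.

(* Translation by t changes the power sums by 2ta (degree 2) and, if a = 0, by
   3tb (degree 3), so it preserves them only if a = b = 0 or t = 0. *)
Lemma sols2_diff_inj n a b c : resolvent a b c != 0 ->
  {in sols2 n a b c &, injective (fun q : ('I_n * 'I_n) * ('I_n * 'I_n) =>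
     (q.1.1%:Z - q.1.2%:Z, q.1.1%:Z - q.2.2%:Z))}.
Proof.
move=> nz [[x1 y1] [x2 y2]] [[x1' y1'] [x2' y2']].
rewrite !inE /power_diff /= => /and3P[/eqP Ea /eqP Eb /eqP Ec].
move=> /and3P[/eqP Ea' /eqP Eb' /eqP Ec'] [E1 E2].
pose t := x1%:Z - x1'%:Z.
have Ex1 : x1%:Z = x1'%:Z + t by rewrite /t; ring.
have Ey1 : y1%:Z = y1'%:Z + t by rewrite -[LHS](subKr x1%:Z) E1 /t; ring.
have Ey2 : y2%:Z = y2'%:Z + t by rewrite -[LHS](subKr x1%:Z) E2 /t; ring.
(* [x2] enters neither difference; the linear equation carries the shift over to it. *)
have Ex2 : x2%:Z = x2'%:Z + t.
  have -> : x2%:Z = a - (x1%:Z - y1%:Z) + y2%:Z by rewrite -Ea; ring.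
  by rewrite E1 Ey2 -Ea'; ring.
rewrite Ex1 Ex2 Ey1 Ey2 in Ea Eb Ec.
have ta0 : t * a = 0.
  apply: (@mulfI _ 2) => //.
  by rewrite mulr0 -[RHS](subrr b) -{1}Eb -Eb' -Ea'; ring.
have tb0 : t * b = 0.
  have : 3 * (t * b) + 3 * t * (t * a) = 0.
    by rewrite -[RHS](subrr c) -{1}Ec -Ec' -Eb' -Ea'; ring.
  by rewrite ta0 mulr0 addr0 => /eqP; rewrite mulf_eq0 => /eqP.
have t0 : t = 0.
  apply/eqP; apply: contraR nz => t_neq0.
  move/eqP: ta0; rewrite mulf_eq0 (negPf t_neq0) => /eqP ->.
  move/eqP: tb0; rewrite mulf_eq0 (negPf t_neq0) => /eqP ->.
  by rewrite /resolvent; apply/eqP; ring.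
rewrite t0 !addr0 in Ex1 Ex2 Ey1 Ey2.
by congr ((_, _), (_, _)); apply: val_inj; apply: (can_inj absz_nat).
Qed.

(** * Counting solutions in two pairs *)

Definition signed_divisors m : seq int :=
  map Posz (divisors m) ++ map (fun d => - d%:Z) (divisors m).

Lemma mem_signed_divisors m (u : int) :
  (0 < m)%N -> (`|u| %| m)%N -> u \in signed_divisors m.
Proof.
move=> m_gt0; rewrite dvdn_divisors // mem_cat => um.
have [u_ge0|u_lt0] := leP 0 u; apply/orP; [left|right]; apply/mapP;
  exists `|u|%N => //; lia.
Qed.

Lemma cross_prod_le P (q : ('I_P.+1 * 'I_P.+1) * ('I_P.+1 * 'I_P.+1)) :
  (`|cross_prod q| <= P ^ 4)%N.
Proof.
have le_P (x y : 'I_P.+1) : (`|(x%:Z - y%:Z)%R| <= P)%N.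
  by have := ltn_ord x; have := ltn_ord y; lia.
by rewrite !abszM !expnSr mul1n !leq_mul.
Qed.

(** All solutions share one nonzero value of [cross_prod]. The two differences that determine a
    solution are signed divisors of it, with at most [2 * D] choices each. *)
Lemma card_sols2_le P D a b c :
    (forall m, (0 < m <= P ^ 4)%N -> (size (divisors m) <= D)%N) ->
  resolvent a b c != 0 -> (#|sols2 P.+1 a b c| <= 4 * D ^ 2)%N.
Proof.
move=> hD nz; have [->|[q0 q0S]] := set_0Vmem (sols2 P.+1 a b c).
  by rewrite cards0.
pose m := `|cross_prod q0|%N.
have Em q : q \in sols2 P.+1 a b c -> cross_prod q = cross_prod q0.
  move=> /resolvent_cross_prod Eq.
  by apply: (@mulfI _ 12) => //; rewrite -Eq -(resolvent_cross_prod q0S).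
have m_gt0 : (0 < m)%N.
  rewrite absz_gt0; apply: contraNneq nz => Eq.
  by rewrite (resolvent_cross_prod q0S) Eq mulr0.
have hm : (size (divisors m) <= D)%N by rewrite hD // m_gt0 cross_prod_le.
rewrite cardE -(size_map (fun q : ('I_P.+1 * 'I_P.+1) * ('I_P.+1 * 'I_P.+1) =>
     (q.1.1%:Z - q.1.2%:Z, q.1.1%:Z - q.2.2%:Z))).
apply: leq_trans (_ : size [seq (u, v) | u <- signed_divisors m, v <- signed_divisors m] <= _)%N.
  apply: uniq_leq_size => [|_ /mapP[q qS ->]].
    rewrite map_inj_in_uniq ?enum_uniq // => q q'; rewrite !mem_enum.
    exact: sols2_diff_inj.
  rewrite mem_enum in qS; have Eq := Em q qS.
  apply/allpairsP; eexists (_, _); split; last by [].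
    by apply: mem_signed_divisors => //; rewrite /m -Eq !abszM -!mulnA dvdn_mulr.
  apply: mem_signed_divisors => //; rewrite /m -Eq !abszM -!mulnA.
  by rewrite dvdn_mull // dvdn_mulr.
rewrite size_allpairs size_cat !size_map addnn -mul2n.
by rewrite mulnACA leq_mul // leq_mul.
Qed.

(* The pairs (x_1, y_1), (x_2, y_2) with the common value t at the positions of
   x and of y selected by s, and with p at the remaining positions. *)
Definition glue n (w : (bool * bool) * 'I_n * ('I_n * 'I_n)) :
    ('I_n * 'I_n) * ('I_n * 'I_n) :=
  let: (s, t, p) := w in
  ((if s.1 then t else p.1, if s.2 then t else p.2),
   (if s.1 then p.1 else t, if s.2 then p.2 else t)).

(** The value [t] occurs once among the x and once among the y, so it cancels. *)
Lemma power_diff_glue n k (w : (bool * bool) * 'I_n * ('I_n * 'I_n)) :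
  power_diff k (glue w).1 + power_diff k (glue w).2 = power_diff k w.2.
Proof. by case: w => [[[[] []] t] [x y]]; rewrite /power_diff /=; ring. Qed.

Lemma cross_prod_eq0 n (q : ('I_n * 'I_n) * ('I_n * 'I_n)) :
  cross_prod q = 0 -> exists w, q = glue w.
Proof.
case: q => [[x1 y1] [x2 y2]] /eqP; rewrite !mulf_eq0 /= !subr_eq0 -!orbA !eqz_nat.
case/or4P => /eqP/val_inj E; subst.
- by exists ((true, true), y1, (x2, y2)).
- by exists ((true, false), y2, (x2, y1)).
- by exists ((false, true), y1, (x1, y2)).
- by exists ((false, false), y2, (x1, y1)).
Qed.

(** Every solution is glued: 4 choices of positions, [P.+1] choices of the cancelled value, and at
    most one remaining pair. *)
Lemma card_sols2_trivial_le P a b c :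
  ~~ [&& a == 0, b == 0 & c == 0] -> resolvent a b c = 0 ->
  (#|sols2 P.+1 a b c| <= 4 * P.+1)%N.
Proof.
move=> nz res0.
apply: (@leq_trans #|@glue P.+1 @: setX setT (sols1 P.+1 a b c)|).
  apply/subset_leq_card/subsetP => q qS.
  have [|w Eq] := @cross_prod_eq0 _ q.
    by apply: (@mulfI _ 12) => //; rewrite -(resolvent_cross_prod qS) mulr0.
  apply/imsetP; exists w => //; move: qS; rewrite {}Eq !inE !power_diff_glue.
  by case: w.
apply: leq_trans (leq_imset_card _ _) _.
rewrite cardsX cardsT !card_prod !card_bool card_ord -[leqRHS]muln1.
by rewrite leq_mul2l card_sols1_le1 // orbT.
Qed.

(** * Counting solutions in three pairs *)

(** The first summand bounds the solutions whose first pair leaves a nonzero resolvent, the second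
    one the others. The sum in its last factor covers both cases for the resolvent of (a, b, c)
    itself. *)
Lemma card_sols3_le P D a b c :
    (forall m, (0 < m <= P ^ 4)%N -> (size (divisors m) <= D)%N) ->
    ~~ [&& a == 0, b == 0 & c == 0] ->
  (#|sols3 P.+1 a b c| <=
     4 * (P.+1 * D) ^ 2 + 4 * P.+1 * (4 * P.+1 + 4 * D ^ 2))%N.
Proof.
move=> hD nz.
pose res (r : 'I_P.+1 * 'I_P.+1) :=
  resolvent (a - power_diff 1 r) (b - power_diff 2 r) (c - power_diff 3 r).
pose degen : {set ('I_P.+1 * 'I_P.+1) * (('I_P.+1 * 'I_P.+1) * ('I_P.+1 * 'I_P.+1))} :=
  [set r | res r.1 == 0].
rewrite -(cardsID degen) addnC leq_add //.
  have -> : #|sols3 P.+1 a b c :\: degen| =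
      (\sum_(r | res r != 0)
         #|sols2 P.+1 (a - power_diff 1 r) (b - power_diff 2 r) (c - power_diff 3 r)|)%N.
    rewrite -sum1_card (eq_bigl (fun r => (res r.1 != 0) && (r.2 \in
      sols2 P.+1 (a - power_diff 1 r.1) (b - power_diff 2 r.1) (c - power_diff 3 r.1)))).
      rewrite -(pair_big_dep (fun r => res r != 0) (fun r q => q \in
        sols2 P.+1 (a - power_diff 1 r) (b - power_diff 2 r) (c - power_diff 3 r))
        (fun _ _ => 1%N)).
      by apply: eq_bigr => r _; rewrite sum1_card.
    by case=> r q; rewrite !inE.
  apply: (@leq_trans (\sum_(r | res r != 0%R) 4 * D ^ 2)%N).
    by apply: leq_sum => r; apply: card_sols2_le.
  rewrite sum_nat_const expnMn mulnCA leq_mul2l leq_mul2r.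
  apply/orP; right; apply/orP; right.
  by apply: leq_trans (max_card _) _; rewrite card_prod card_ord.
(* After the cancellation, the first pair and the surviving pair solve the system in two pairs with
   the original right-hand side. *)
pose swap (w : (bool * bool) * 'I_P.+1 * (('I_P.+1 * 'I_P.+1) * ('I_P.+1 * 'I_P.+1))) :=
  (w.2.1, glue (w.1, w.2.2)).
apply: (@leq_trans #|swap @: setX setT (sols2 P.+1 a b c)|).
  apply/subset_leq_card/subsetP => -[r q]; rewrite inE => /andP[rS].
  rewrite inE /= => /eqP res0; rewrite inE /= in rS.
  have [|[w p] Eq] := @cross_prod_eq0 _ q.
    by apply: (@mulfI _ 12) => //; rewrite -(resolvent_cross_prod rS) mulr0.
  apply/imsetP; exists (w, (r, p)); last by rewrite /swap Eq.
  move: rS; rewrite {}Eq !inE !power_diff_glue /=.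
  have E k z : (power_diff k p == z - power_diff k r) =
      (power_diff k r + power_diff k p == z).
    by rewrite eq_sym subr_eq eq_sym addrC.
  by rewrite !E.
apply: leq_trans (leq_imset_card _ _) _.
rewrite cardsX cardsT !card_prod !card_bool card_ord leq_mul2l.
have [/eqP res0|res_neq0] := boolP (resolvent a b c == 0).
  by rewrite (leq_trans (card_sols2_trivial_le _ nz res0)) ?leq_addr ?orbT.
by rewrite (leq_trans (card_sols2_le hD res_neq0)) ?leq_addl ?orbT.
Qed.

Lemma card_sols3_le_divisors P D a b c : (0 < P)%N -> (0 < D)%N ->
    (forall m, (0 < m <= P ^ 4)%N -> (size (divisors m) <= D)%N) ->
    ~~ [&& a == 0, b == 0 & c == 0] ->
  (#|sols3 P.+1 a b c| <= 144 * (P * D) ^ 2)%N.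
Proof.
move=> P_gt0 D_gt0 hD nz; apply: leq_trans (card_sols3_le hD nz) _.
have leP : (P.+1 <= 2 * P)%N by lia.
have leD : (1 <= D ^ 2)%N by rewrite expn_gt0 D_gt0.
(* 36 = 4 + 4 (4 + 4), each term being at most a multiple of [(P.+1 * D) ^ 2]. *)
apply: (@leq_trans (36 * (P.+1 * D) ^ 2)).
  rewrite !expnMn; nia.
rewrite (_ : 144 * (P * D) ^ 2 = 36 * (2 * P * D) ^ 2)%N; last by rewrite !expnMn; ring.
by rewrite leq_mul2l leq_sqr leq_mul2r leP orbT.
Qed.

(** * Passage to [S3] and to real exponents *)

(** Regrouping the two triples into pairs is injective; entries equal to 0 are allowed on the right,
    whence an inequality. *)
Lemma S3_le_card_sols3 P h :
  (S3 P h <= #|sols3 P.+1 (h 0%R 0%R) (h 0%R 1%R) (h 0%R 2%R)|)%N.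
Proof.
pose f (xy : {ffun 'I_3 -> 'I_P.+1} * {ffun 'I_3 -> 'I_P.+1}) :=
  ((xy.1 0, xy.2 0), ((xy.1 1, xy.2 1), (xy.1 2, xy.2 2))).
have f_inj : injective f.
  move=> [x y] [x' y'] [] E0 F0 E1 F1 E2 F2.
  by congr pair; apply/ffunP => -[[|[|[|//]]] lt_i];
     [move: E0|move: E1|move: E2|move: F0|move: F1|move: F2];
     congr (_ = _); congr (_ _); apply: val_inj.
rewrite /S3 -(card_imset _ f_inj); apply/subset_leq_card/subsetP => _ /imsetP[xy + ->].
rewrite inE => /andP[_ /forallP eqs].
have i1 : lift ord0 ord0 = 1 :> 'I_3 by apply: val_inj.
have i2 : lift ord0 (lift ord0 ord0) = 2 :> 'I_3 by apply: val_inj.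
have E (j : 'I_3) : power_diff j.+1 (f xy).2.1 + power_diff j.+1 (f xy).2.2
    == h 0 j - power_diff j.+1 (f xy).1.
  rewrite -(eqP (eqs j)) !big_ord_recl big_ord0 i2 i1 /power_diff /=.
  by apply/eqP; ring.
by rewrite !inE; apply/and3P; split; [apply: (E 0) | apply: (E 1) | apply: (E 2)].
Qed.

Theorem corollary1p2 (R : realType) (eps : R) (heps : 0 < eps) :
  exists C : R, 0 < C /\
    forall (h : 'rV[int]_3) (P : nat), h != 0 -> (0 < P)%N ->
      (S3 P h)%:R <= C * (P%:R `^ (2 + eps)).
Proof.
(* Chosen so that P^4 is at most P^(eps k); the successor makes [k] positive, as comparing [k]-th
   powers requires. *)
pose k := (Num.bound (4 / eps)).+1.
have k_eps : 4 <= eps * k%:R.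
  rewrite mulrC -ler_pdivrMr //; apply/ltW.
  apply: lt_trans (archi_boundP _) _; first by rewrite divr_ge0 // ltW.
  by rewrite ltr_nat.
have [K K_gt0 hK] := divisor_bound (2 * k).
exists (144 * K%:R); split; first by rewrite mulr_gt0 ?ltr0n.
move=> h P h_neq0 P_gt0.
have P_gt0R : 0 < P%:R :> R by rewrite ltr0n.
have P_ge1 : 1 <= P%:R :> R by rewrite ler1n.
have Peps_ge1 : 1 <= P%:R `^ eps :> R.
  by rewrite -[leLHS](powRr0 (P%:R : R)); apply: ler_powR P_ge1 _ _ (ltW heps).
pose D := (\max_(m < (P ^ 4).+1 | (0 < m)%N) size (divisors m))%N.
have hD m : (0 < m <= P ^ 4)%N -> (size (divisors m) <= D)%N.
  move=> /andP[m_gt0 le_m].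
  exact: (@leq_bigmax_cond _ _ (fun m : 'I__ => size (divisors m))
           (Ordinal (le_m : (m < (P ^ 4).+1)%N))).
have D_gt0 : (0 < D)%N by apply: leq_trans (hD 1%N _); rewrite // expn_gt0 P_gt0.
have DK : (D ^ (2 * k) <= K * P ^ 4)%N.
  rewrite /D; elim/big_ind: _ => //.
  - by move=> m1 m2 ? ?; rewrite /maxn; case: ifP.
  - move=> m m_gt0; apply: leq_trans (hK m m_gt0) _.
    by rewrite leq_mul2l -ltnS ltn_ord orbT.
have D2_le : (D ^ 2)%:R <= K%:R * P%:R `^ eps :> R.
  (* The [k]-th powers compare by [DK], [K <= K ^ k] and the choice of [k]. *)
  rewrite -(@ler_pXn2r _ k) ?nnegrE ?ler0n //; last first.
    by rewrite mulr_ge0 ?ler0n ?powR_ge0.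
  rewrite -natrX -expnM (le_trans (_ : _ <= (K * P ^ 4)%:R)) ?ler_nat //.
  rewrite natrM exprMn ler_pM ?ler0n //.
    by rewrite -natrX ler_nat -[leqLHS]expn1 leq_pexp2l.
  rewrite natrX -!powR_mulrn ?powR_ge0 ?ler0n // -powRrM.
  by apply: ler_powR.
have nz : ~~ [&& h 0 0 == 0, h 0 1 == 0 & h 0 2 == 0].
  apply: contra h_neq0 => /and3P[/eqP h0 /eqP h1 /eqP h2].
  apply/eqP/rowP => -[[|[|[|//]]] lt_i]; rewrite mxE.
  - by rewrite -h0; congr (h _ _); apply: val_inj.
  - by rewrite -h1; congr (h _ _); apply: val_inj.
  - by rewrite -h2; congr (h _ _); apply: val_inj.
apply: (@le_trans _ _ (144 * (P * D) ^ 2)%:R).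
  by rewrite ler_nat (leq_trans (S3_le_card_sols3 P h)) ?card_sols3_le_divisors.
have -> : P%:R `^ (2 + eps) = P%:R ^+ 2 * P%:R `^ eps :> R.
  rewrite powRD ?powR_mulrn ?ler0n //.
  by rewrite (gt_eqF P_gt0R) implybT.
have -> : (144 * (P * D) ^ 2)%:R = 144 * (P%:R ^+ 2 * (D ^ 2)%:R) :> R.
  by rewrite expnMn -natrX -!natrM.
by rewrite -mulrA ler_pM2l ?ltr0n // [leRHS]mulrCA ler_pM2l ?exprn_gt0.
Qed.
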